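(* Let $G=(V,A)$ be an Eulerian directed graph, i.e. $\partial(\{v\})=0$ for all $v\in V$ ($G$ need not be connected), and let $b:\mathcal{P}(V)\to\mathbb{Z}$ be submodular. Then $$\sigma^*=\max\left\{\frac{-b(X)}{\delta(X)} : X\subseteq V,\ \delta(X)>0\right\},$$ or $\sigma^*=0$ if the value of this maximum is negative.
   Context: $G=(V,A)$ is a finite directed graph and $\mathcal{P}(V)$ is the power set of $V$. For $X\subseteq V$, $\varrho(X)$ and $\delta(X)$ denote the number of edges entering $X$ and leaving $X$, respectively, and $\partial(X):=\varrho(X)-\delta(X)$. For $x\in\mathbb{R}^A$, $\varrho_x(X)$ and $\delta_x(X)$ denote the sum of $x(e)$ over the edges $e$ entering, resp. leaving, $X$. The function $b$ is submodular if $b(X)+b(Y)\ge b(X\cup Y)+b(X\cap Y)$ for all $X,Y\subseteq V$. A submodular flow is a vector $x\in\mathbb{R}^A$ with $\varrho_x(X)-\delta_x(X)\le b(X)$ for every $X\subseteq V$. The spread of $x\in\mathbb{R}^A$ is $\sigma(x):=\max_{a\in A}x(a)-\min_{a\in A}x(a)$, and $\sigma^*$ is the minimum of $\sigma(x)$ over all submodular flows $x$. Standing assumptions: $G$ has no isolated vertex, and a submodular flow exists, i.e. $b(U)\ge 0$ for every $U\subseteq V$ with $\varrho(U)=0$ and $\delta(U)=0$. *)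

(* Defs.v *)
From mathcomp Require Import all_boot all_order all_algebra.
From mathcomp Require Import reals.

Set Implicit Arguments.
Unset Strict Implicit.
Unset Printing Implicit Defensive.

Import Order.TTheory GRing.Theory Num.Theory.
Local Open Scope ring_scope.

(* Edges form a type of their own, so parallel edges are allowed.  Loops are
   allowed too; a loop neither enters nor leaves any set of vertices. *)
Record digraph (V A : finType) := Digraph { tail : A -> V; head : A -> V }.

Section Digraph.
Variables (V A : finType) (G : digraph V A).

Definition entering (X : {set V}) : {set A} :=
  [set a | (tail G a \notin X) && (head G a \in X)].

Definition leaving (X : {set V}) : {set A} :=
  [set a | (tail G a \in X) && (head G a \notin X)].

Definition indeg (X : {set V}) : nat := #|entering X|.
Definition outdeg (X : {set V}) : nat := #|leaving X|.

Definition imbalance (X : {set V}) : int := (indeg X)%:Z - (outdeg X)%:Z.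

Definition eulerian : Prop := forall v : V, imbalance [set v] = 0.

Definition no_isolated_vertex : Prop :=
  forall v : V, exists a : A, tail G a = v \/ head G a = v.

End Digraph.

Definition submodular (V : finType) (b : {set V} -> int) : Prop :=
  forall X Y : {set V}, b (X :|: Y) + b (X :&: Y) <= b X + b Y.

Section Extrema.
Variables (R : realType) (I : finType).

(* The maximum (minimum) of f over the indices satisfying P; by convention it
   is 0 if there is no such index. *)
Definition max_over (P : pred I) (f : I -> R) : R :=
  if [pick i | P i] is Some i0 then f [arg max_(i > i0 | P i) f i]%O else 0.

Definition min_over (P : pred I) (f : I -> R) : R :=
  if [pick i | P i] is Some i0 then f [arg min_(i < i0 | P i) f i]%O else 0.

End Extrema.

Section SubmodularFlow.
Variables (R : realType) (V A : finType) (G : digraph V A).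

Definition inflow (x : {ffun A -> R}) (X : {set V}) : R :=
  \sum_(a in entering G X) x a.

Definition outflow (x : {ffun A -> R}) (X : {set V}) : R :=
  \sum_(a in leaving G X) x a.

Definition submodular_flow (b : {set V} -> int) (x : {ffun A -> R}) : Prop :=
  forall X : {set V}, inflow x X - outflow x X <= (b X)%:~R.

Definition spread (x : {ffun A -> R}) : R :=
  max_over predT x - min_over predT x.

Definition is_min_spread (b : {set V} -> int) (s : R) : Prop :=
  (exists2 x : {ffun A -> R}, submodular_flow b x & spread x = s) /\
  (forall x : {ffun A -> R}, submodular_flow b x -> s <= spread x).

(* If no X satisfies 0 < outdeg G X, i.e. if every edge is a loop (or there is
   no edge), this is 0 by the convention of max_over. *)
Definition max_ratio (b : {set V} -> int) : R :=
  max_over (fun X : {set V} => (0 < outdeg G X)%N)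
           (fun X => - (b X)%:~R / (outdeg G X)%:R).

End SubmodularFlow.

(* Main.v *)
Require Import Defs.
From mathcomp Require Import all_boot all_order all_algebra.
From mathcomp Require Import reals.
From mathcomp Require Import lra.
Set Implicit Arguments.
Unset Strict Implicit.
Unset Printing Implicit Defensive.
Import Order.TTheory GRing.Theory Num.Theory.
Local Open Scope ring_scope.

(** In an Eulerian graph every vertex set [X] is entered by as many edges as it
    is left by.  A flow [x] that takes its values in an interval of length [s]
    therefore has net inflow at least [- s * outdeg X] into [X], so that
    [- b X / outdeg X <= s]: this is the lower bound on the spread
    ([ratio_le_spread]).

    Conversely, let [s >= 0] be at least every ratio.  Then
    [- s * outdeg X <= b X] holds for every [X]: it is the definition of [s] if
    [outdeg X > 0], and the existence condition for flows if [outdeg X = 0],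
    as then [indeg X = 0] too.  This inequality is the cut condition
    [demand f g X <= b X] for the constant capacities [f = 0] and [g = s], where
    [demand f g X] is the least net inflow into [X] that is possible within the
    capacities.  The cut condition suffices for a submodular flow [x] with
    [0 <= x <= s] ([submodular_flow_between]), and such an [x] has spread at
    most [s].

    The feasibility theorem is proved by fixing the value of one edge at a time.
    Fixing edge [a] at [t] increases the demand of the sets entered by [a] by
    [t - f a] and that of the sets left by [a] by [g a - t].  The first kind of
    set bounds [t] from above, the second from below.  The bounds
    are compatible because [demand f g] is supermodular, with excess at least
    [g a - f a] on a pair [X], [Y] such that [a] enters [X] and leaves [Y]
    ([demand_crossing]), whereas [b] is submodular. *)

(** * Extrema over a finite type *)

Section Extrema.
Variables (R : realType) (I : finType).
Implicit Types (P : pred I) (f : I -> R).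

Lemma le_max_over P f i : P i -> f i <= max_over P f.
Proof.
move=> Pi; rewrite /max_over; case: pickP => [i0 Pi0|/(_ i)]; last by rewrite Pi.
by case: arg_maxP => // j _; apply.
Qed.

Lemma max_over_le P f c :
  0 <= c -> (forall i, P i -> f i <= c) -> max_over P f <= c.
Proof.
move=> c0 fc; rewrite /max_over; case: pickP => [i0 Pi0|//].
by case: arg_maxP => // j Pj _; apply: fc.
Qed.

Lemma min_over_le P f i : P i -> min_over P f <= f i.
Proof.
move=> Pi; rewrite /min_over; case: pickP => [i0 Pi0|/(_ i)]; last by rewrite Pi.
by case: arg_minP => // j _; apply.
Qed.

Lemma le_min_over P f c :
  c <= 0 -> (forall i, P i -> c <= f i) -> c <= min_over P f.
Proof.
move=> c0 fc; rewrite /min_over; case: pickP => [i0 Pi0|//].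
by case: arg_minP => // j Pj _; apply: fc.
Qed.

End Extrema.

Section Spread.
Variables (R : realType) (A : finType).
Implicit Type x : {ffun A -> R}.

Lemma spread_ge0 x : 0 <= spread x.
Proof.
rewrite /spread; case: (pickP (@predT A)) => [a _|A0].
  by rewrite subr_ge0 (le_trans (min_over_le (P := predT) x (i := a) _) (le_max_over _ _)).
by rewrite /max_over /min_over; case: pickP => [a|_]; rewrite ?A0 ?subrr.
Qed.

Lemma spread_le x s :
  0 <= s -> (forall a, 0 <= x a <= s) -> spread x <= s.
Proof.
move=> s0 xs; rewrite /spread.
have : max_over predT x <= s by apply: max_over_le => // a _; case/andP: (xs a).
have : 0 <= min_over predT x by apply: le_min_over => // a _; case/andP: (xs a).
by move=> *; lra.
Qed.

End Spread.

(** * Edge counts in Eulerian graphs *)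

Section Degrees.
Variables (V A : finType) (G : digraph V A).

Lemma imbalanceE (X : {set V}) :
  imbalance G X = \sum_a ((Defs.head G a \in X)%:Z - (tail G a \in X)%:Z).
Proof.
have cardE (B : {set A}) : #|B|%:Z = \sum_a (a \in B)%:Z.
  by rewrite -sum1_card big_mkcond /= -natz natr_sum; apply: eq_bigr => a _; case: ifP.
rewrite /imbalance /indeg /outdeg !cardE -sumrB; apply: eq_bigr => a _.
by rewrite !inE; case: (Defs.head G a \in X); case: (tail G a \in X).
Qed.

Lemma eulerian_indeg : eulerian G -> forall X : {set V}, indeg G X = outdeg G X.
Proof.
move=> eulG X; suff : imbalance G X = 0.
  by move/eqP; rewrite subr_eq0 => /eqP [].
rewrite imbalanceE.
(* Summed over the vertices of X, the imbalances of single vertices give that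
   of X, as each edge counts its head positively and its tail negatively. *)
have -> : \sum_a ((Defs.head G a \in X)%:Z - (tail G a \in X)%:Z)
          = \sum_(v in X) imbalance G [set v].
  under [RHS]eq_bigr => v _ do rewrite imbalanceE.
  rewrite exchange_big; apply: eq_bigr => a _.
  have memE u : (u \in X)%:Z = \sum_(v in X) (u \in [set v])%:Z.
    under eq_bigr => v _ do rewrite inE eq_sym.
    have [uX|uX] := boolP (u \in X).
      by rewrite (bigD1 u) //= eqxx big1 ?addr0 // => v /andP[_ /negbTE ->].
    by rewrite big1 // => v vX; case: eqP uX => // <-; rewrite vX.
  by rewrite sumrB !memE.
by apply: big1.
Qed.

End Degrees.

(** * Feasibility of submodular flows with capacities *)

Section Feasibility.
Variables (R : realType) (V A : finType) (G : digraph V A).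
Implicit Types (f g : A -> R) (X Y : {set V}).

Definition demand f g X : R :=
  \sum_(a in entering G X) f a - \sum_(a in leaving G X) g a.

Lemma demandE f g X :
  demand f g X =
    \sum_a ((a \in entering G X)%:R * f a - (a \in leaving G X)%:R * g a).
Proof.
rewrite /demand sumrB; congr (_ - _); rewrite big_mkcond;
  by apply: eq_bigr => a _; case: ifP; rewrite (mul1r, mul0r).
Qed.

(** An edge between [X :\: Y] and [Y :\: X] contributes an [f] and a [- g] to
    the demands of [X] and [Y], and nothing to those of the union and the
    intersection.  Every other edge contributes the same to both sides. *)
Lemma demand_crossing f g X Y a :
  (forall e, f e <= g e) -> a \in entering G X -> a \in leaving G Y ->
  demand f g X + demand f g Y + (g a - f a)
    <= demand f g (X :|: Y) + demand f g (X :&: Y).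
Proof.
move=> fg aX aY; rewrite !demandE -!big_split /= [leLHS]addrC.
rewrite (bigD1 a) //= [leRHS](bigD1 a) //= addrA lerD //.
  by move: aX aY; rewrite !inE => /andP[/negbTE -> ->] /andP[-> /negbTE ->] /=; lra.
apply: ler_sum => e _; have := fg e; rewrite !inE.
by case: (tail G e \in X); case: (tail G e \in Y);
   case: (Defs.head G e \in X); case: (Defs.head G e \in Y) => /= *; lra.
Qed.

Definition fix_edge f a t : A -> R := fun e => if e == a then t else f e.

Lemma demand_fix_edge f g a t X :
  demand (fix_edge f a t) (fix_edge g a t) X =
    demand f g X + (a \in entering G X)%:R * (t - f a)
                 + (a \in leaving G X)%:R * (g a - t).
Proof.
rewrite !demandE (bigD1 a) //= [in RHS](bigD1 a) //= /fix_edge eqxx.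
rewrite (eq_bigr (fun e => (e \in entering G X)%:R * f e
                           - (e \in leaving G X)%:R * g e)); first by lra.
by move=> e /negbTE ->.
Qed.

Variable b : {set V} -> R.
Hypothesis b_submod : forall X Y, b (X :|: Y) + b (X :&: Y) <= b X + b Y.

Lemma fix_edge_feasible f g a :
  (forall e, f e <= g e) -> (forall X, demand f g X <= b X) ->
  exists t, [/\ f a <= t, t <= g a &
    forall X, demand (fix_edge f a t) (fix_edge g a t) X <= b X].
Proof.
move=> fg fgb.
(* The least value allowed by the sets that a leaves. *)
pose t := \big[Num.max/f a]_(Y | a \in leaving G Y) (g a - (b Y - demand f g Y)).
have tf : f a <= t by apply: bigmax_ge_id.
exists t; split=> //.
  by apply/bigmax_leP; split=> // Y _; have := fgb Y; lra.
move=> X; rewrite demand_fix_edge.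
have [aX|aX] := boolP (a \in entering G X).
  have -> : (a \in leaving G X) = false.
    by move: aX; rewrite !inE => /andP[/negbTE ->].
  suff : t <= f a + (b X - demand f g X) by rewrite mul1r mul0r; lra.
  apply/bigmax_leP; split=> [|Y aY]; first by have := fgb X; lra.
  have := demand_crossing fg aX aY.
  by have := b_submod X Y; have := fgb (X :|: Y); have := fgb (X :&: Y); lra.
rewrite mul0r addr0; have [aX'|aX'] := boolP (a \in leaving G X).
  suff : g a - (b X - demand f g X) <= t by rewrite mul1r; lra.
  exact: (le_bigmax_cond _ (fun Y => g a - (b Y - demand f g Y))).
by rewrite mul0r addr0.
Qed.

(** Later steps only narrow the capacities, so an edge stays fixed once its
    lower and upper capacities agree. *)
Lemma fix_edges_feasible (s : seq A) f g :
  (forall e, f e <= g e) -> (forall X, demand f g X <= b X) ->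
  exists f' g', [/\ forall e, f e <= f' e <= g' e /\ g' e <= g e,
    forall X, demand f' g' X <= b X & {in s, f' =1 g'}].
Proof.
elim: s f g => [|a s IHs] f g fg fgb.
  by exists f, g; split=> // e; rewrite lexx fg.
have [t [ft tg tb]] := fix_edge_feasible a fg fgb.
have [|f' [g' [bnd dem eqs]]] := IHs _ _ _ tb.
  by move=> e; rewrite /fix_edge; case: ifP.
exists f', g'; split=> // e.
  by have := bnd e; rewrite /fix_edge; case: eqP => [->|_] [] /andP[]; lra.
rewrite inE => /orP[/eqP ->|]; last exact: eqs.
have := bnd a; rewrite /fix_edge eqxx => -[/andP[ta fga] gt].
by apply/eqP; rewrite eq_le fga (le_trans gt ta).
Qed.

(** Frank's feasibility theorem, for a fully submodular bound: once all edges
    are fixed, the demand of a set is its net inflow. *)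
Lemma submodular_flow_between f g :
  (forall e, f e <= g e) -> (forall X, demand f g X <= b X) ->
  exists2 x : {ffun A -> R}, (forall e, f e <= x e <= g e) &
    forall X, inflow G x X - outflow G x X <= b X.
Proof.
move=> fg fgb; have [f' [g' [bnd dem eqA]]] := fix_edges_feasible (enum A) fg fgb.
exists [ffun e => f' e] => [e|X].
  by rewrite ffunE; have [/andP[-> le1] le2] := bnd e; rewrite (le_trans le1).
apply: le_trans (dem X); rewrite /demand /inflow /outflow lerB //.
  by apply: ler_sum => e _; rewrite ffunE.
by apply: ler_sum => e _; rewrite ffunE eqA // mem_enum.
Qed.

End Feasibility.

(** * The spread of submodular flows *)

Section MinSpread.
Variables (R : realType) (V A : finType) (G : digraph V A).
Variable b : {set V} -> int.
Hypothesis eulG : eulerian G.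

Lemma ratio_le_spread (x : {ffun A -> R}) (X : {set V}) :
  submodular_flow G b x -> (0 < outdeg G X)%N ->
  - (b X)%:~R / (outdeg G X)%:R <= spread x.
Proof.
move=> flow_x X0; rewrite ler_pdivrMr ?ltr0n //.
have := flow_x X; rewrite /inflow /outflow.
have : \sum_(a in entering G X) min_over predT x <= \sum_(a in entering G X) x a.
  by apply: ler_sum => a _; apply: min_over_le.
have : \sum_(a in leaving G X) x a <= \sum_(a in leaving G X) max_over predT x.
  by apply: ler_sum => a _; apply: le_max_over.
rewrite !sumr_const -/(indeg G X) -/(outdeg G X) (eulerian_indeg eulG).
by rewrite /spread mulrBl !mulr_natr; lra.
Qed.

Lemma flow_of_spread_le (s : R) :
  submodular b ->
  (forall U, indeg G U = 0%N -> outdeg G U = 0%N -> 0 <= b U) ->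
  0 <= s ->
  (forall X, (0 < outdeg G X)%N -> - (b X)%:~R / (outdeg G X)%:R <= s) ->
  exists2 x : {ffun A -> R}, submodular_flow G b x & spread x <= s.
Proof.
move=> subb feas s0 ratio_s.
pose bR X : R := (b X)%:~R.
have subbR X Y : bR (X :|: Y) + bR (X :&: Y) <= bR X + bR Y.
  by rewrite /bR -!intrD ler_int.
have [|X|x bnd flow_x] :=
  @submodular_flow_between R V A G bR subbR (fun=> 0) (fun=> s).
- by [].
- rewrite /demand big1 // sumr_const -/(outdeg G X) sub0r -mulr_natr.
  have [X0|] := posnP (outdeg G X).
    by rewrite X0 mulr0 oppr0 ler0z feas // (eulerian_indeg eulG).
  by move=> X0; rewrite lerNl -ler_pdivrMr ?ltr0n // ratio_s.
- by exists x => //; apply: spread_le.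
Qed.

End MinSpread.

Theorem theorem3p3 (R : realType) (V A : finType) (G : digraph V A)
    (b : {set V} -> int)
    (hiso : no_isolated_vertex G)
    (heul : eulerian G)
    (hsub : submodular b)
    (hfeas : forall U : {set V},
        indeg G U = 0%N -> outdeg G U = 0%N -> 0 <= b U) :
  is_min_spread G b
    (if max_ratio R G b < 0 then 0 else max_ratio R G b).
Proof.
set s := (if _ then _ else _).
have s0 : 0 <= s by rewrite /s; case: ltP.
have ratio_s : max_ratio R G b <= s by rewrite /s; case: ltP => // /ltW.
have s_min x : submodular_flow G b x -> s <= spread x.
  move=> flow_x; rewrite /s; case: ifP => _; first exact: spread_ge0.
  by apply: max_over_le (spread_ge0 _) _ => X; apply: ratio_le_spread.
split=> //.
have [|x flow_x x_s] := flow_of_spread_le heul hsub hfeas s0.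
  move=> X X0; apply: le_trans ratio_s.
  exact: (le_max_over (P := fun X => (0 < outdeg G X)%N)).
by exists x => //; apply/eqP; rewrite eq_le x_s s_min.
Qed.
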